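(* Let $G$ be a group, let $R$ be an indecomposable commutative ring with unit and let $\mathscr G$ and $\mathscr G'$ be $G$-graded Hausdorff ample groupoids such that $\mathscr G$ satisfies the local bisection hypothesis (relative to $R$ and the grading). Then the following are equivalent. (1) There is a graded isomorphism $\varphi\colon \mathscr G\to \mathscr G'$. (2) There is a diagonal-preserving graded isomorphism $\Phi\colon R\mathscr G\to R\mathscr G'$ of $R$-algebras. (3) There is a diagonal-preserving graded isomorphism $\Phi\colon R\mathscr G\to R\mathscr G'$ of rings.
   Context: A commutative ring $R$ with unit is indecomposable if $0\neq 1$ and $0,1$ are its only idempotents. Groupoids. A groupoid $\mathscr G$ is a small category with all arrows invertible; $\mathscr G^{(0)}$ is the set of objects (identified with the identity arrows), $\mathscr G^{(1)}$ the set of arrows, $\boldsymbol d,\boldsymbol r$ the domain and range maps; $\alpha\beta$ is defined when $\boldsymbol d(\alpha)=\boldsymbol r(\beta)$. A topological groupoid has topologies making all structure maps continuous; it is étale if $\boldsymbol d$ is a local homeomorphism (then all structure maps are, and $\mathscr G^{(0)}$ is open in $\mathscr G^{(1)}$). A Boolean space is a Hausdorff space with a basis of compact open sets. An ample groupoid is an étale groupoid with $\mathscr G^{(0)}$ a Boolean space; it is Hausdorff if $\mathscr G^{(1)}$ is Hausdorff. An isomorphism of topological groupoids is a continuous functor with a continuous inverse. A local bisection is an open subset $U\subseteq\mathscr G^{(1)}$ on which $\boldsymbol d$ and $\boldsymbol r$ are injective. Gradings. A $G$-graded groupoid is a topological groupoid with a continuous functor (cocycle) $c\colon\mathscr G\to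 G$, $G$ being a discrete one-object groupoid; $\mathscr G_g=c^{-1}(g)$. A graded isomorphism of $G$-graded groupoids is an isomorphism of topological groupoids commuting with the cocycles. Groupoid algebra. $R\mathscr G$ is the $R$-module of compactly supported locally constant functions $\mathscr G^{(1)}\to R$ with product $fg(\gamma)=\sum_{\boldsymbol d(\alpha)=\boldsymbol d(\gamma)}f(\gamma\alpha^{-1})g(\alpha)$. It is $G$-graded, the component $R\mathscr G_g$ consisting of the functions supported on $\mathscr G_g$. The diagonal subalgebra $D(\mathscr G)$ is the set of functions supported on $\mathscr G^{(0)}$. An isomorphism $\Phi\colon R\mathscr G\to R\mathscr G'$ is diagonal-preserving if $\Phi(D(\mathscr G))=D(\mathscr G')$, and graded if $\Phi(R\mathscr G_g)=R\mathscr G'_g$ for all $g\in G$. Normalizer. For $g\in G$ let $N_g$ be the set of $m\in R\mathscr G_g$ for which there is $m'\in R\mathscr G_{g^{-1}}$ with $mm'm=m$, $m'mm'=m'$ and $mD(\mathscr G)m'\cup m'D(\mathscr G)m\subseteq D(\mathscr G)$. The (graded) normalizer of $D(\mathscr G)$ is $N=\bigcup_{g\in G}N_g$. $\mathscr G$ satisfies the local bisection hypothesis (relative to $R$ and the grading) if $\mathrm{supp}(m)=\{\gamma\mid m(\gamma)\ne0\}$ is a local bisection for every $m\in N$. *)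

(* Defs.v *)
From HB Require Import structures.
From mathcomp Require Import all_boot all_algebra.
From mathcomp Require Import all_classical topology.

Set Implicit Arguments.
Unset Strict Implicit.
Unset Printing Implicit Defensive.

Import GRing.Theory.

Local Open Scope classical_set_scope.
Local Open Scope ring_scope.

Definition indecomposable (R : comPzRingType) : Prop :=
  (0 : R) <> 1 /\ forall e : R, e * e = e -> e = 0 \/ e = 1.

Definition local_homeomorphism (X Y : topologicalType) (f : X -> Y) : Prop :=
  forall x : X, exists (U : set X) (g : Y -> X),
    [/\ open U, U x, open (f @` U), {in U, cancel f g} &
        {within U, continuous f} /\ {within f @` U, continuous g}].

Definition boolean_space (X : topologicalType) : Prop :=
  hausdorff_space X /\ basis [set U : set X | compact U /\ open U].

(* Objects and arrows are kept as separate spaces; since [gid] is continuous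
   with continuous left inverse [gd], it identifies the objects with the
   subspace of identity arrows.  [gcomp] is total, but every axiom constrains
   it only on composable pairs, where [gd a = gr b]. *)
Record topGroupoid := TopGroupoid {
  obj : topologicalType;
  arr : topologicalType;
  gd : arr -> obj;
  gr : arr -> obj;
  gid : obj -> arr;
  ginv : arr -> arr;
  gcomp : arr -> arr -> arr;
  gd_id : forall x, gd (gid x) = x;
  gr_id : forall x, gr (gid x) = x;
  gd_comp : forall a b, gd a = gr b -> gd (gcomp a b) = gd b;
  gr_comp : forall a b, gd a = gr b -> gr (gcomp a b) = gr a;
  gcomp1l : forall a, gcomp (gid (gr a)) a = a;
  gcomp1r : forall a, gcomp a (gid (gd a)) = a;
  gcompA : forall a b c, gd a = gr b -> gd b = gr c ->
    gcomp a (gcomp b c) = gcomp (gcomp a b) c;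
  gd_inv : forall a, gd (ginv a) = gr a;
  gr_inv : forall a, gr (ginv a) = gd a;
  gcompVl : forall a, gcomp (ginv a) a = gid (gd a);
  gcompVr : forall a, gcomp a (ginv a) = gid (gr a);
  continuous_gd : continuous gd;
  continuous_gr : continuous gr;
  continuous_gid : continuous gid;
  continuous_ginv : continuous ginv;
  continuous_gcomp :
    {within [set p : arr * arr | gd p.1 = gr p.2],
      continuous (fun p : arr * arr => gcomp p.1 p.2)}
}.

Definition etale (X : topGroupoid) : Prop := local_homeomorphism (@gd X).

Definition ample (X : topGroupoid) : Prop := etale X /\ boolean_space (obj X).

Definition hausdorff_groupoid (X : topGroupoid) : Prop :=
  hausdorff_space (arr X).

Definition local_bisection (X : topGroupoid) (U : set (arr X)) : Prop :=
  [/\ open U, set_inj U (@gd X) & set_inj U (@gr X)].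

Record gradedGroupoid (G : groupType) := GradedGroupoid {
  gg_groupoid :> topGroupoid;
  cocycle : arr gg_groupoid -> G;
  cocycle1 : forall x, cocycle (gid x) = 1%g;
  cocycleM : forall a b, gd a = gr b ->
    cocycle (gcomp a b) = (cocycle a * cocycle b)%g;
  continuous_cocycle : continuous (cocycle : _ -> discrete_topology G)
}.

Record continuousFunctor (X Y : topGroupoid) := ContinuousFunctor {
  fobj : obj X -> obj Y;
  farr :> arr X -> arr Y;
  functor_d : forall a, gd (farr a) = fobj (gd a);
  functor_r : forall a, gr (farr a) = fobj (gr a);
  functor_id : forall x, farr (gid x) = gid (fobj x);
  functor_comp : forall a b, gd a = gr b ->
    farr (gcomp a b) = gcomp (farr a) (farr b);
  continuous_fobj : continuous fobj;
  continuous_farr : continuous farr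
}.

Definition groupoid_isomorphism (X Y : topGroupoid)
    (phi : continuousFunctor X Y) : Prop :=
  exists psi : continuousFunctor Y X,
    [/\ cancel (fobj phi) (fobj psi), cancel (fobj psi) (fobj phi),
        cancel phi psi & cancel psi phi].

Definition graded_isomorphism (G : groupType) (X Y : gradedGroupoid G)
    (phi : continuousFunctor X Y) : Prop :=
  groupoid_isomorphism phi /\ forall a, cocycle (phi a) = cocycle a.

Section GroupoidAlgebra.
Variable R : comPzRingType.

Definition supp (T : Type) (f : T -> R) : set T := [set t | f t <> 0].

Definition locally_constant (T : topologicalType) (f : T -> R) : Prop :=
  forall t : T, \forall u \near t, f u = f t.

Definition groupoid_algebra (X : topGroupoid) : set (arr X -> R) :=
  [set f | locally_constant f /\ compact (supp f)].

(* For [g] in [groupoid_algebra X] and [X] étale and Hausdorff, the sum has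
   finite support; a finitely supported sum [\sum_(_ \in _)] is by convention
   [0] otherwise. *)
Definition convolution (X : topGroupoid) (f g : arr X -> R) : arr X -> R :=
  fun c => \sum_(a \in [set a | gd a = gd c]) f (gcomp c (ginv a)) * g a.

Definition diagonal (X : topGroupoid) : set (arr X -> R) :=
  [set f | groupoid_algebra f /\ supp f `<=` range (@gid X)].

Section Graded.
Variable G : groupType.

Definition homogeneous (X : gradedGroupoid G) (g : G) : set (arr X -> R) :=
  [set f | groupoid_algebra f /\ supp f `<=` @cocycle G X @^-1` [set g]].

Definition normalizer_comp (X : gradedGroupoid G) (g : G) :
    set (arr X -> R) :=
  [set m | homogeneous g m /\ exists m' : arr X -> R,
    [/\ homogeneous g^-1%g m',
        convolution (convolution m m') m = m,
        convolution (convolution m' m) m' = m' &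
        forall f, diagonal f ->
          diagonal (convolution (convolution m f) m') /\
          diagonal (convolution (convolution m' f) m)]].

Definition normalizer (X : gradedGroupoid G) : set (arr X -> R) :=
  \bigcup_(g in [set: G]) @normalizer_comp X g.

Definition local_bisection_hypothesis (X : gradedGroupoid G) : Prop :=
  forall m : arr X -> R, normalizer m -> local_bisection (supp m).

End Graded.

(* The groupoid algebras are in general not unital, and are handled as subsets
   of the function spaces; the values of [Phi] outside of
   [groupoid_algebra X] are irrelevant. *)
Definition ring_isomorphism (X Y : topGroupoid)
    (Phi : (arr X -> R) -> (arr Y -> R)) : Prop :=
  [/\ set_bij (@groupoid_algebra X) (@groupoid_algebra Y) Phi,
      forall f g, groupoid_algebra f -> groupoid_algebra g ->
        Phi (f + g) = Phi f + Phi g &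
      forall f g, groupoid_algebra f -> groupoid_algebra g ->
        Phi (convolution f g) = convolution (Phi f) (Phi g)].

Definition algebra_isomorphism (X Y : topGroupoid)
    (Phi : (arr X -> R) -> (arr Y -> R)) : Prop :=
  ring_isomorphism Phi /\
  forall (a : R) (f : arr X -> R), groupoid_algebra f ->
    Phi (fun c => a * f c) = (fun c => a * Phi f c).

Definition diagonal_preserving (X Y : topGroupoid)
    (Phi : (arr X -> R) -> (arr Y -> R)) : Prop :=
  Phi @` @diagonal X = @diagonal Y.

Definition graded_map (G : groupType) (X Y : gradedGroupoid G)
    (Phi : (arr X -> R) -> (arr Y -> R)) : Prop :=
  forall g : G, Phi @` homogeneous (X := X) g = homogeneous (X := Y) g.

End GroupoidAlgebra.

(* Main.v *)
(* Let Psi be the inverse of a diagonal-preserving graded ring isomorphism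
   Phi. Since R is indecomposable, the idempotents of the diagonal subalgebras
   are the indicators of compact open sets of objects, so a point y of the
   objects of Y determines a point x of the objects of X, characterised by
   f(y) = 0 <-> (Psi f)(x) = 0 for all diagonal f.

   This extends to arrows: a corresponds to d when f(a) = 0 <-> (Psi f)(d) = 0
   for all f. Indicators of homogeneous compact open bisections V of Y are
   normalizers, hence so is Psi 1_V, whose support is then a bisection. If V
   contains a, Psi 1_V does not vanish at d, and the sources of a and d
   correspond, then a corresponds to d. The point is that another bisection W
   with Psi 1_W nonzero at d must contain a: near the source of d, the product
   of Psi 1_(V^-1) and Psi 1_W is diagonal and nonzero, so 1_(V^-1) * 1_W is
   nonzero at the source of a; general f then follow by writing them as sums of
   multiples of indicators of bisections.

   The correspondence maps supports to supports, hence is a homeomorphism, and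
   it is multiplicative because the support of Psi 1_V * Psi 1_W lies in the
   product of the two supports, where V and W can be shrunk. *)

From mathcomp Require Import all_boot all_algebra.
From mathcomp Require Import all_classical topology.
(* After [topology], whose [diagonal] would otherwise shadow the diagonal
   subalgebra. *)
Require Import Defs.

Set Implicit Arguments.
Unset Strict Implicit.
Unset Printing Implicit Defensive.

Import GRing.Theory.

Local Open Scope classical_set_scope.
Local Open Scope ring_scope.


(** * Groupoids and compactness *)

(** If [P K] fails, the sets [A] such that [P] holds on the part of [K] outside [A] form a proper
    filter containing [K]. Its cluster point in [K] contradicts the local hypothesis there. *)
Lemma compact_induction (T : topologicalType) (K : set T) (P : set T -> Prop) :
  compact K -> P set0 -> (forall A B, A `<=` B -> P B -> P A) ->
  (forall A B, P A -> P B -> P (A `|` B)) ->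
  (forall t, K t -> exists2 N, nbhs t N & P N) -> P K.
Proof.
move=> cK P0 Psub PU Ploc; apply: contrapT => nPK.
pose F : set_system T := [set A | P (K `\` A)].
have FF : ProperFilter F.
  split; first by rewrite /F /= setD0.
  split=> [|A B PA PB|A B AB PA]; rewrite /F /=.
  - by rewrite setDT.
  - by rewrite setDIr; apply: PU.
  - by apply: Psub PA; exact: setDS.
have [|t [Kt clt]] := cK F FF; first by rewrite /F /= setDv.
have [N Nt PN] := Ploc t Kt.
have [|u [nNu Nu]] := clt (~` N) N _ Nt; last exact: nNu.
by rewrite /F /= setDE setCK; apply: Psub PN; exact: subIsetr.
Qed.

Section Groupoid.
Variable X : topGroupoid.
Implicit Types a b c : arr X.

Lemma ginv_unique a b : gd a = gr b -> gcomp a b = gid (gr a) -> b = ginv a.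
Proof.
move=> ab e; rewrite -[LHS]gcomp1l -ab -gcompVl -gcompA ?gd_inv// e.
by rewrite -gd_inv gcomp1r.
Qed.

Lemma ginvK : involutive (@ginv X).
Proof.
by move=> a; rewrite -(@ginv_unique (ginv a) a) ?gd_inv// gcompVl gr_inv.
Qed.

Lemma gcompK a b : gd a = gr b -> gcomp (gcomp a b) (ginv b) = a.
Proof. by move=> ab; rewrite -gcompA ?gr_inv// gcompVr -ab gcomp1r. Qed.

Lemma gcompVK a b : gd a = gd b -> gcomp (gcomp a (ginv b)) b = a.
Proof. by move=> ab; rewrite -gcompA ?gd_inv ?gr_inv// gcompVl -ab gcomp1r. Qed.

Lemma gcompKV a b : gr a = gr b -> gcomp a (gcomp (ginv a) b) = b.
Proof. by move=> ab; rewrite gcompA ?gd_inv ?gr_inv// gcompVr ab gcomp1l. Qed.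

Lemma ginv_gid (x : obj X) : ginv (gid x) = gid x.
Proof.
have idM : gcomp (gid x) (gid x) = gid x.
  by have := gcomp1l (gid x); rewrite gr_id.
by apply/esym/ginv_unique; rewrite ?gd_id ?gr_id.
Qed.

Lemma range_gidE a : range (@gid X) a <-> gid (gd a) = a.
Proof. by split=> [[x _ <-]|<-]; [rewrite gd_id|exists (gd a)]. Qed.

Lemma gcomp_nbhs a b (O : set (arr X)) : gd a = gr b -> nbhs (gcomp a b) O ->
  exists A B, [/\ nbhs a A, nbhs b B &
    forall a' b', A a' -> B b' -> gd a' = gr b' -> O (gcomp a' b')].
Proof.
move=> ab /((subspace_continuousP _ _).1 (@continuous_gcomp X) (a, b) ab).
move=> [[A B] /= [nA nB] AB]; exists A, B; split=> // a' b' Aa Bb.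
by apply: (AB (a', b')).
Qed.

Lemma open_gd (U : set (arr X)) : etale X -> open U -> open (@gd X @` U).
Proof.
move=> et oU; rewrite openE => _ [a Ua <-].
have [W [g [oW Wa oWd gK [_ cg]]]] := et a.
move: cg; rewrite continuous_open_subspace// => cg.
have Wda : (gd (t:=X) @` W) (gd a) by exists a.
have /cg cga : gd a \in gd (t:=X) @` W by apply/mem_set.
have ga : g (gd a) = a by apply/gK/mem_set.
have : nbhs (g (gd a)) (U `&` W).
  by rewrite ga; apply: open_nbhs_nbhs; split=> //; apply: openI.
move=> /cga; rewrite nbhs_simpl /= => nU.
have nW : nbhs (gd a) (gd (t:=X) @` W) by apply: open_nbhs_nbhs.
apply: filterS (filterI nU nW) => y [[Ugy Wgy] [w Ww wy]].
by exists w => //; move: Ugy; rewrite -wy gK//; exact/mem_set.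
Qed.

Lemma open_gr (U : set (arr X)) : etale X -> open U -> open (@gr X @` U).
Proof.
move=> et oU; suff -> : gr (t:=X) @` U = gd (t:=X) @` (@ginv X @^-1` U).
  by apply: open_gd => //; apply: open_comp => // ? _; exact: continuous_ginv.
apply/seteqP; split=> _ [a Ua <-].
  by exists (ginv a); rewrite /= ?ginvK ?gd_inv.
by exists (ginv a); rewrite //= gr_inv.
Qed.

Lemma etale_gd_inj a : etale X ->
  exists U, [/\ open U, U a & set_inj U (@gd X)].
Proof.
move=> /(_ a)[U [g [oU Ua _ gK _]]]; exists U; split=> // u v Uu Uv e.
by rewrite -(gK u Uu) -(gK v Uv) e.
Qed.

Lemma etale_gr_inj a : etale X ->
  exists U, [/\ open U, U a & set_inj U (@gr X)].
Proof.
move=> /(etale_gd_inj (ginv a))[U [oU Ua gU]].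
exists (@ginv X @^-1` U); split=> //.
  by apply: open_comp => // ? _; exact: continuous_ginv.
move=> u v; rewrite !inE /= => Uu Uv e; apply: (can_inj ginvK).
by apply: gU; rewrite ?inE// !gd_inv.
Qed.

(** For [a] close to an identity arrow, [a] and [gid (gd a)] both lie in an open set where [gd] is
    injective; having the same source, they coincide. *)
Lemma open_range_gid : etale X -> open (range (@gid X)).
Proof.
move=> et; rewrite openE => _ [x _ <-].
have [U [oU Ux Ui]] := etale_gd_inj (gid x) et.
have nU : nbhs (gid x) U by apply: open_nbhs_nbhs.
have nV : nbhs (gid x) ((@gid X \o @gd X) @^-1` U).
  apply: open_nbhs_nbhs; split; last by rewrite /= gd_id.
  apply: open_comp => // b _; apply: continuous_comp.
    exact: continuous_gd.
  exact: continuous_gid.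
apply: (filterS _ (filterI nU nV)) => a [Ua Va]; apply/range_gidE.
by apply: Ui; rewrite ?inE// gd_id.
Qed.

End Groupoid.

(** * Compact open homogeneous bisections *)

Lemma continuous_image_compact (S T : topologicalType) (f : S -> T) (A : set S) :
  continuous f -> compact A -> compact (f @` A).
Proof. by move=> cf; apply: continuous_compact; exact: continuous_subspaceT. Qed.

Section CompactBisection.
Variables (G : groupType) (X : gradedGroupoid G).
Hypotheses (X_ample : ample X) (X_hausdorff : hausdorff_groupoid X).
Implicit Types (a b c : arr X) (U V W : set (arr X)).

(* Homogeneity for the grading is part of the definition: it is what puts the
   indicators of these sets in the normalizer. *)
Definition compact_bisection V :=
  [/\ compact V, local_bisection V &
    exists g, V `<=` @cocycle G X @^-1` [set g]].

Let X_etale : etale X := X_ample.1.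

Lemma cocycleV a : cocycle (ginv a) = (cocycle a)^-1%g.
Proof.
have h : gd (ginv a) = gr a by exact: gd_inv.
apply: (@mulIg _ (cocycle a)); rewrite mulVg -(cocycleM h) gcompVl.
exact: cocycle1.
Qed.

Lemma bisection_gd_inj V a b :
  compact_bisection V -> V a -> V b -> gd a = gd b -> a = b.
Proof. by case=> _ [_ + _] _ Va Vb; apply; apply/mem_set. Qed.

Lemma bisection_gr_inj V a b :
  compact_bisection V -> V a -> V b -> gr a = gr b -> a = b.
Proof. by case=> _ [_ _ +] _ Va Vb; apply; apply/mem_set. Qed.

Lemma bisection_open V : compact_bisection V -> open V.
Proof. by case=> _ []. Qed.

Lemma bisection_compact V : compact_bisection V -> compact V.
Proof. by case. Qed.

Lemma compact_bisectionI V W :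
  open W -> closed W -> compact_bisection V -> compact_bisection (V `&` W).
Proof.
move=> oW cW [cV [oV dV rV] [g Vg]]; split; last first.
- by exists g => a [/Vg].
- split; first exact: openI.
    by move=> a b; rewrite !inE => -[Va _] [Vb _]; apply: dV; exact/mem_set.
  by move=> a b; rewrite !inE => -[Va _] [Vb _]; apply: rV; exact/mem_set.
- exact: compact_closedI.
Qed.

(** A local section [g] of [gd] carries a small compact open set [K] of objects onto the required
    set, which gives compactness. Injectivity of [gr] and homogeneity come from shrinking the open
    set [O] first. *)
Lemma compact_bisection_basis a U : nbhs a U ->
  exists V, [/\ compact_bisection V, V a & V `<=` U].
Proof.
rewrite nbhsE => -[U0 [oU0 U0a] U0U].
have [W [g [oW Wa oWd gK [_ cg]]]] := X_etale a.
have [W' [oW' W'a W'r]] := etale_gr_inj a X_etale.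
pose O := U0 `&` W `&` W' `&` (@cocycle G X @^-1` [set cocycle a]).
have oO : open O.
  apply: openI; first by do 2?apply: openI.
  have /continuousP := @continuous_cocycle G X.
  by apply; exact: discrete_open.
have dOa : nbhs (gd a) (@gd X @` O).
  by apply: open_nbhs_nbhs; split; [exact: open_gd|exists a].
have [_ [_ Kb]] := X_ample.2.
have [K [[cK oK] Ka] KO] := Kb _ _ dOa.
have VE : O `&` (@gd X @^-1` K) = g @` K.
  apply/seteqP; split=> [b [[[[_ Wb] _] _] Kb']|_ [k Kk <-]].
    by exists (gd b) => //; apply/gK/mem_set.
  have [b Ob bk] := KO k Kk; rewrite -bk gK; last first.
    by apply/mem_set; case: Ob => -[[]].
  by split=> //=; rewrite bk.
exists (O `&` (@gd X @^-1` K)); split.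
- split.
  + rewrite VE; apply: continuous_compact cK.
    apply: continuous_subspaceW cg => k /KO[b [[[_ Wb] _] _] <-].
    by exists b.
  + split.
    * apply: openI => //; move/continuousP: (@continuous_gd X); exact.
    * move=> b c; rewrite !inE => -[[[[_ /mem_set Wb] _] _] _].
      by move=> [[[[_ /mem_set Wc] _] _] _] e; rewrite -(gK b) // e gK.
    * move=> b c; rewrite !inE => -[[[_ Wb] _] _] [[[_ Wc] _] _].
      by apply: W'r; exact/mem_set.
  + by exists (cocycle a) => b [[]].
- by [].
- by move=> b [[[[/U0U]]]].
Qed.

Lemma compact_bisection_inv V :
  compact_bisection V -> compact_bisection (@ginv X @^-1` V).
Proof.
move=> [cV [oV dV rV] [g Vg]]; split.
- have -> : @ginv X @^-1` V = @ginv X @` V.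
    apply/seteqP; split=> [a Va|_ [a Va <-]]; last by rewrite /= ginvK.
    by exists (ginv a); rewrite ?ginvK.
  by apply: continuous_image_compact cV; exact: continuous_ginv.
- split.
  + by move/continuousP: (@continuous_ginv X); exact.
  + move=> a b; rewrite !inE /= => Va Vb e; apply: (can_inj (@ginvK X)).
    by apply: rV; rewrite ?inE// !gr_inv.
  + move=> a b; rewrite !inE /= => Va Vb e; apply: (can_inj (@ginvK X)).
    by apply: dV; rewrite ?inE// !gd_inv.
- by exists g^-1%g => a /Vg /=; rewrite cocycleV => <-; rewrite invgK.
Qed.

(** Sources are kept as identity arrows rather than as objects, so that their indicators are
    elements of the diagonal subalgebra. *)
Definition source V : set (arr X) := [set gid (gd a) | a in V].

Lemma sourceE V a :
  source V a <-> gid (gd a) = a /\ (exists2 b, V b & gd b = gd a).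
Proof.
split=> [[b Vb <-]|[ea [b Vb ba]]]; last by exists b; rewrite ?ba.
by rewrite gd_id; split=> //; exists b.
Qed.

Lemma source_sub V : source V `<=` range (@gid X).
Proof. by move=> _ [a _ <-]; exists (gd a). Qed.

Lemma source_id V a : V a -> source V (gid (gd a)).
Proof. by move=> Va; exists a. Qed.

Lemma compact_bisection_source V :
  compact_bisection V -> compact_bisection (source V).
Proof.
move=> [cV [oV dV rV] [g Vg]]; split.
- apply: (@continuous_image_compact _ _ (fun a => gid (gd a))) => // a.
  by apply: continuous_comp; [exact: continuous_gd|exact: continuous_gid].
- split.
  + have -> : source V = range (@gid X) `&` (@gd X @^-1` (@gd X @` V)).
      apply/seteqP; split=> a.
        by move=> /sourceE[? ?]; split=> //; apply/range_gidE.
      by move=> [/range_gidE ? ?]; apply/sourceE.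
    apply: openI; first exact: open_range_gid.
    by move/continuousP: (@continuous_gd X); apply; exact: open_gd.
  + move=> a b; rewrite !inE => -[a' _ <-] [b' _ <-].
    by rewrite !gd_id => ->.
  + move=> a b; rewrite !inE => -[a' _ <-] [b' _ <-].
    by rewrite !gr_id => ->.
- by exists 1%g => _ [a _ <-]; exact: cocycle1.
Qed.

Definition set_comp V W : set (arr X) :=
  [set c | exists a b, [/\ V a, W b, gd a = gr b & c = gcomp a b]].

(** Composable pairs form a closed set of pairs because the space of objects is Hausdorff; hence the
    composable pairs from [V] and [W] form a compact set, whose image under composition is taken. *)
Lemma compact_set_comp V W : compact V -> compact W -> compact (set_comp V W).
Proof.
move=> cV cW; pose D := [set p : arr X * arr X | gd p.1 = gr p.2].
have -> : set_comp V W = (fun p => gcomp p.1 p.2) @` ((V `*` W) `&` D).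
  apply/seteqP; split=> [_ [a [b [Va Wb ab ->]]]|_ [[a b] [[/= Va Wb] ab] <-]].
    by exists (a, b).
  by exists a, b.
apply: continuous_compact.
  by apply: continuous_subspaceW (@continuous_gcomp X) => p [].
apply: compact_closedI; first exact: compact_setX.
move=> [a b] clD; have [hX _] := X_ample.2; apply: hX => A B nA nB.
have [|[a' b'] [Dab [/= Aa Bb]]] :=
    clD ((@gd X @^-1` A) `*` (@gr X @^-1` B)).
  exists (@gd X @^-1` A, @gr X @^-1` B) => //; split=> /=.
    exact: continuous_gd.
  exact: continuous_gr.
by exists (gd a'); split=> //; rewrite [gd a']Dab.
Qed.

(** An arrow [c'] near [c] factors as [a'] followed by [gcomp (ginv a') c'], where [a'] is close to
    [a] and has the range of [c']. Such an [a'] exists because [gr] is open, and continuity keeps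
    the second factor in [W]. *)
Lemma open_set_comp V W : open V -> open W -> open (set_comp V W).
Proof.
move=> oV oW; rewrite openE => _ [a [b [Va Wb ab ->]]]; rewrite /interior.
set c := gcomp a b.
have ca : gr a = gr c by rewrite gr_comp.
have bE : b = gcomp (ginv a) c.
  by rewrite /c gcompA ?gd_inv// gcompVl ab gcomp1l.
have nW : nbhs (gcomp (ginv a) c) W by rewrite -bE; exact: open_nbhs_nbhs.
have vc : gd (ginv a) = gr c by rewrite gd_inv.
have [A [C [nA nC AC]]] := gcomp_nbhs vc nW.
have nA' : nbhs a (V `&` @ginv X @^-1` A).
  by apply: filterI; [exact: open_nbhs_nbhs|exact: continuous_ginv].
move: nA'; rewrite nbhsE => -[B [oB Ba] BVA].
have nB : nbhs c (@gr X @^-1` (@gr X @` B)).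
  apply: open_nbhs_nbhs; split; last by rewrite /= -ca; exists a.
  by move/continuousP: (@continuous_gr X); apply; exact: open_gr.
apply: filterS (filterI nC nB) => c' [Cc' [a' Ba' a'c']].
have [Va' Aa'] := BVA _ Ba'.
exists a', (gcomp (ginv a') c'); split=> //.
- by apply: AC; rewrite // gd_inv.
- by rewrite gr_comp ?gr_inv// gd_inv.
- by rewrite gcompKV.
Qed.

End CompactBisection.

(** * The groupoid algebra *)

Section LocallyConstant.
Variables (R : comPzRingType) (T : topologicalType).
Implicit Types f g : T -> R.

Definition ind (V : set T) (r : R) : T -> R := fun c => if c \in V then r else 0.

Lemma ind_in (V : set T) r c : V c -> ind V r c = r.
Proof. by move=> /mem_set Vc; rewrite /ind Vc. Qed.

Lemma ind_notin (V : set T) r c : ~ V c -> ind V r c = 0.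
Proof. by rewrite /ind; case: (boolP (c \in V)) => // /set_mem. Qed.

Lemma ind_neq0 (V : set T) r c : ind V r c <> 0 -> V c.
Proof. by move=> h; apply: contrapT => /(ind_notin r). Qed.

Lemma locally_constant_open f (P : set R) :
  locally_constant f -> open (f @^-1` P).
Proof.
by move=> lf; rewrite openE => t Pt; apply: filterS (lf t) => u fu; rewrite /= fu.
Qed.

Lemma locally_constant_closed f (P : set R) :
  locally_constant f -> closed (f @^-1` P).
Proof.
move=> lf; rewrite -[f @^-1` P]setCK; apply: open_closedC.
exact: (@locally_constant_open f (~` P)).
Qed.

Lemma locally_constant_ind (V : set T) r :
  open V -> closed V -> locally_constant (ind V r).
Proof.
move=> oV cV t; have [Vt|nVt] := pselect (V t).
  by apply: filterS (open_nbhs_nbhs (conj oV Vt)) => u Vu; rewrite !ind_in.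
have oVc : open (~` V) by exact: closed_openC.
by apply: filterS (open_nbhs_nbhs (conj oVc nVt)) => u Vu; rewrite !ind_notin.
Qed.

Lemma locally_constantD f g :
  locally_constant f -> locally_constant g -> locally_constant (f + g).
Proof.
by move=> lf lg t; apply: filterS2 (lf t) (lg t) => u; rewrite !fctE => -> ->.
Qed.

Lemma supp_ind (V : set T) r : supp (ind V r) `<=` V.
Proof. by move=> t; exact: ind_neq0. Qed.

End LocallyConstant.

Section Convolution.
Variables (R : comPzRingType) (X : topGroupoid).
Implicit Types (f g h : arr X -> R) (a b c : arr X).

Lemma convolution_eq0 f g c :
  (forall a, gd a = gd c -> f (gcomp c (ginv a)) * g a = 0) ->
  convolution f g c = 0.
Proof. by move=> fg0; exact: fsbig1. Qed.

Lemma convolution_neq0 f g c : convolution f g c <> 0 ->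
  exists a, [/\ gd a = gd c, f (gcomp c (ginv a)) <> 0 & g a <> 0].
Proof.
move=> fg; apply: contrapT => nex; apply: fg; apply: convolution_eq0 => a ac.
apply: contrapT => fga; apply: nex; exists a; split=> // e; apply: fga.
  by rewrite e mul0r.
by rewrite e mulr0.
Qed.

Lemma convolution_single f g c b : gd b = gd c ->
  (forall a, gd a = gd c -> f (gcomp c (ginv a)) <> 0 -> g a <> 0 -> a = b) ->
  convolution f g c = f (gcomp c (ginv b)) * g b.
Proof.
move=> bc fg; rewrite /convolution -(@fsbig_widen _ _ _ _ [set b]).
- by rewrite fsbig_set1.
- by move=> _ ->.
- move=> a [/= ac nab]; apply: contrapT => fga; apply: nab; apply: fg => // e.
    by apply: fga; rewrite e mul0r.
  by apply: fga; rewrite e mulr0.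
Qed.

Lemma convolution_unitr f g c : supp g `<=` range (@gid X) ->
  convolution f g c = f c * g (gid (gd c)).
Proof.
move=> gu; rewrite (@convolution_single _ _ _ (gid (gd c))) ?gd_id//.
  by rewrite ginv_gid gcomp1r.
by move=> a ac _ /gu /range_gidE <-; rewrite ac.
Qed.

Lemma convolution_unitl f g c : supp f `<=` range (@gid X) ->
  convolution f g c = f (gid (gr c)) * g c.
Proof.
move=> fu; rewrite (@convolution_single _ _ _ c) ?gcompVr// => a ac /fu.
move=> /range_gidE; rewrite gd_comp ?gr_inv// gd_inv => e _.
by rewrite -(gcompVK (esym ac)) -e gcomp1l.
Qed.

(** Sums of infinite support are 0 by convention, so all three sums are first restricted to the same
    finite set [D], where they split. *)
Lemma convolutionDl f g h c :
  finite_set [set a | gd a = gd c /\ h a <> 0] ->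
  convolution (f + g) h c = convolution f h c + convolution g h c.
Proof.
set D := [set a | _] => fD.
have E k : convolution k h c = \sum_(a \in D) k (gcomp c (ginv a)) * h a.
  rewrite /convolution -(@fsbig_widen _ _ _ _ D) => [//|a []//|a [/= ac nDa]].
  have -> : h a = 0 by apply: contrapT => ha; apply: nDa.
  by rewrite mulr0.
rewrite !E -fsbig_split//; apply: eq_fsbigr => a _.
by rewrite fctE mulrDl.
Qed.

Lemma convolutionDr f g h c :
  finite_set [set a | gd a = gd c /\ g a <> 0] ->
  finite_set [set a | gd a = gd c /\ h a <> 0] ->
  convolution f (g + h) c = convolution f g c + convolution f h c.
Proof.
set D1 := [set a | _] => fD1; set D2 := [set a | _] => fD2.
have E k : (forall a, ~ (D1 `|` D2) a -> gd a = gd c -> k a = 0) ->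
    convolution f k c = \sum_(a \in D1 `|` D2) f (gcomp c (ginv a)) * k a.
  move=> k0; rewrite /convolution -(@fsbig_widen _ _ _ _ (D1 `|` D2)) => [//||].
    by move=> a [] [].
  by move=> a [/= ac nDa]; rewrite k0// mulr0.
have g0 a : ~ (D1 `|` D2) a -> gd a = gd c -> g a = 0.
  by move=> nD ac; apply: contrapT => ga; apply: nD; left.
have h0 a : ~ (D1 `|` D2) a -> gd a = gd c -> h a = 0.
  by move=> nD ac; apply: contrapT => ha; apply: nD; right.
rewrite !E//; last by move=> a nD ac; rewrite fctE g0// h0// addr0.
rewrite -fsbig_split ?finite_setU//; apply: eq_fsbigr => a _.
by rewrite fctE mulrDr.
Qed.

End Convolution.

Section Algebra.
Variables (R : comPzRingType) (G : groupType) (X : gradedGroupoid G).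
Hypotheses (X_ample : ample X) (X_hausdorff : hausdorff_groupoid X).
Implicit Types (f g : arr X -> R) (a b c : arr X) (U V W : set (arr X)).

Lemma algebra_sub f (K : set (arr X)) :
  locally_constant f -> compact K -> supp f `<=` K -> groupoid_algebra f.
Proof.
move=> lf cK fK; split=> //; apply: subclosed_compact cK fK.
exact: (@locally_constant_closed _ _ f (~` [set 0])).
Qed.

Lemma algebraD f g :
  groupoid_algebra f -> groupoid_algebra g -> groupoid_algebra (f + g).
Proof.
move=> [lf cf] [lg cg]; apply: algebra_sub (compactU cf cg) _.
  exact: locally_constantD.
move=> a fga; apply: contrapT => nU; apply: fga; rewrite fctE.
have -> : f a = 0 by apply: contrapT => fa; apply: nU; left.
have -> : g a = 0 by apply: contrapT => ga; apply: nU; right.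
by rewrite addr0.
Qed.

Lemma algebra_ind_open V r :
  compact V -> open V -> groupoid_algebra (ind V r : _ -> R).
Proof.
move=> cV oV; apply: (algebra_sub _ cV); last exact: supp_ind.
by apply: locally_constant_ind => //; exact: (compact_closed X_hausdorff cV).
Qed.

Lemma algebra_ind V r :
  compact_bisection V -> groupoid_algebra (ind V r : _ -> R).
Proof. by move=> [cV [oV _ _] _]; exact: algebra_ind_open. Qed.

Lemma algebra0 : groupoid_algebra (0 : arr X -> R).
Proof.
have -> : 0 = ind set0 0 :> (arr X -> R) by apply/funext => c; rewrite ind_notin.
by apply: algebra_ind_open; [exact: compact0|exact: open0].
Qed.

(** Additive induction over the algebra: near each point of its compact support, [f] is a constant
    multiple of the indicator of a bisection. Keeping [V] inside [supp f] ensures that a zero of [f]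
    lies in none of the bisections used. *)
Lemma algebra_span (Z : set (arr X -> R)) f : groupoid_algebra f ->
  Z 0 -> (forall f g, Z f -> Z g -> Z (f + g)) ->
  (forall V r, compact_bisection V -> V `<=` supp f -> Z (ind V r)) -> Z f.
Proof.
move=> [lf cf] Z0 ZD Zind.
(* The clopen [C] allows the supports to be made disjoint in unions. *)
pose P A := exists B, [/\ open B, closed B, A `<=` B & forall C, open C ->
  closed C -> Z (fun c => if c \in B `&` C then f c else 0)].
suff [B [_ _ fB /(_ _ openT closedT)]] : P (supp f).
  set h := (fun c => _); suff -> : h = f by [].
  apply/funext => c; rewrite /h; case: ifPn => // /negP nB.
  apply: esym; apply: contrapT => fc; apply: nB; rewrite inE.
  by split=> //; exact: fB.
apply: (compact_induction cf).
- exists set0; split=> [||//|C oC cC]; [exact: open0|exact: closed0|].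
  set h := (fun c => _); suff -> : h = 0 by [].
  by apply/funext => c; rewrite /h set0I in_set0.
- move=> A A' AA' [B [oB cB A'B ZB]]; exists B; split=> //.
  exact: subset_trans A'B.
- move=> A A' [B [oB cB AB ZB]] [B' [oB' cB' AB' ZB']].
  exists (B `|` B'); split; [exact: openU|exact: closedU|exact: setUSS|].
  move=> C oC cC; have oD : open (C `\` B).
    by rewrite setDE; apply: openI => //; exact: closed_openC.
  have cD : closed (C `\` B).
    by rewrite setDE; apply: closedI => //; exact: open_closedC.
  have := ZD _ _ (ZB _ oC cC) (ZB' _ oD cD); set h := (X in Z X).
  set h' := (fun c => _); suff -> : h' = h by [].
  apply/funext => c; rewrite /h /h' !fctE.
  have [Bc|nBc] := pselect (B c); have [B'c|nB'c] := pselect (B' c);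
  have [Cc|nCc] := pselect (C c);
  by do 3 case: ifPn;
    rewrite ?notin_setE ?inE /setI /setU /setD /= ?addr0 ?add0r; tauto.
- move=> t ft; have nt : nbhs t [set c | f c = f t] by exact: lf.
  have [V [bV Vt Vf]] := compact_bisection_basis X_ample nt.
  exists V; first by apply: open_nbhs_nbhs; split=> //; exact: bisection_open bV.
  exists V; split=> //.
  + exact: bisection_open bV.
  + exact: (compact_closed X_hausdorff (bisection_compact bV)).
  + move=> C oC cC; have bVC := compact_bisectionI oC cC bV.
    have := Zind _ (f t) bVC; rewrite /ind; set h := (X in Z X).
    set h' := (fun c => _); have -> : h' = h.
      apply/funext => c; rewrite /h' /h; case: ifPn => //.
      by rewrite inE => -[/Vf].
    by apply=> c [/Vf /= fc _]; rewrite /supp /= fc.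
Qed.

Lemma algebra_finite_fiber f x :
  groupoid_algebra f -> finite_set [set a | gd a = x /\ f a <> 0].
Proof.
move=> Af; apply: (algebra_span Af
  (Z := fun f => finite_set [set a | gd a = x /\ f a <> 0])).
- by apply: sub_finite_set (finite_set0 _) => a [].
- move=> g h fg fh; have : finite_set ([set a | gd a = x /\ g a <> 0] `|`
      [set a | gd a = x /\ h a <> 0]) by rewrite finite_setU.
  apply: sub_finite_set => a [ax]; rewrite fctE => gha.
  have [ga|ga] := pselect (g a = 0); last by left.
  by right; split=> // ha; apply: gha; rewrite ga ha addr0.
- move=> V r bV _; have [[a [ax /ind_neq0 Va]]|nex] :=
      pselect (exists a, gd a = x /\ ind V r a <> 0).
    apply: sub_finite_set (finite_set1 a) => b [bx /ind_neq0 Vb].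
    by apply: (bisection_gd_inj bV) => //; rewrite ax.
  by apply: sub_finite_set (finite_set0 _) => a ha; apply: nex; exists a.
Qed.

(** As [gd] is injective on [W], an arrow has at most one right factor in [W], so each convolution
    sum has at most one nonzero term. *)
Lemma convolution_ind V W r s : compact_bisection W ->
  convolution (ind V r) (ind W s) = ind (set_comp V W) (r * s) :> (arr X -> R).
Proof.
move=> bW; apply/funext => c.
have [[a [b [Va Wb ab ->]]]|nVW] := pselect (set_comp V W c).
  rewrite [RHS]ind_in; last by exists a, b.
  rewrite (@convolution_single _ _ _ _ _ b) ?gd_comp//; last first.
    by move=> b' bb' _ /ind_neq0 Wb'; apply: (bisection_gd_inj bW).
  by rewrite gcompK// !ind_in.
rewrite [RHS]ind_notin//; apply: contrapT => /convolution_neq0.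
move=> [b [bc /ind_neq0 Vcb /ind_neq0 Wb]]; apply: nVW.
exists (gcomp c (ginv b)), b; split=> //.
  by rewrite gd_comp ?gr_inv// gd_inv.
by rewrite gcompVK.
Qed.

Lemma algebra_convolution f g : groupoid_algebra f -> groupoid_algebra g ->
  groupoid_algebra (convolution f g).
Proof.
move=> Af Ag; apply: (algebra_span Af
  (Z := fun f => groupoid_algebra (convolution f g))).
- suff -> : convolution 0 g = 0 by exact: algebra0.
  by apply/funext => c; apply: convolution_eq0 => a _; rewrite mul0r.
- move=> f1 f2 A1 A2.
  suff -> : convolution (f1 + f2) g = convolution f1 g + convolution f2 g.
    exact: algebraD.
  by apply/funext => c; apply: convolutionDl; exact: algebra_finite_fiber.
- move=> V r bV _.
  (* Membership of [g] is carried through the induction, because additivity of the convolution in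
     [g] requires finite fibres. *)
  suff [] : groupoid_algebra g /\
    groupoid_algebra (convolution (ind V r) g) by [].
  apply: (algebra_span Ag (Z := fun g => groupoid_algebra g /\
    groupoid_algebra (convolution (ind V r) g))).
  + split; first exact: algebra0.
    suff -> : convolution (ind V r) 0 = 0 by exact: algebra0.
    by apply/funext => c; apply: convolution_eq0 => a _; rewrite mulr0.
  + move=> g1 g2 [A1 B1] [A2 B2]; split; first exact: algebraD.
    suff -> : convolution (ind V r) (g1 + g2) =
      convolution (ind V r) g1 + convolution (ind V r) g2 by exact: algebraD.
    by apply/funext => c; apply: convolutionDr; exact: algebra_finite_fiber.
  + move=> W s bW _; split; first exact: algebra_ind.
    rewrite convolution_ind//; apply: algebra_ind_open.
      exact: compact_set_comp (bisection_compact bV) (bisection_compact bW).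
    exact: open_set_comp (bisection_open bV) (bisection_open bW).
Qed.

End Algebra.

(** * The diagonal and its normalizer *)

Section Diagonal.
Variables (R : comPzRingType) (G : groupType) (X : gradedGroupoid G).
Hypotheses (R_indec : indecomposable R).
Hypotheses (X_ample : ample X) (X_hausdorff : hausdorff_groupoid X).
Implicit Types (f g : arr X -> R) (a b c : arr X) (U V W : set (arr X)).

Lemma oneN0 : (1 : R) <> 0.
Proof. by move=> e; apply: R_indec.1. Qed.

Lemma diagonal_ind V r : compact_bisection V -> V `<=` range (@gid X) ->
  diagonal (ind V r : _ -> R).
Proof.
move=> bV Vu; split; first exact: algebra_ind.
exact: subset_trans (@supp_ind _ _ _ _) Vu.
Qed.

Lemma diagonal_source V r :
  compact_bisection V -> diagonal (ind (source V) r : _ -> R).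
Proof.
move=> bV; apply: diagonal_ind; last exact: source_sub.
exact: compact_bisection_source.
Qed.

(** Convolution of diagonal elements is pointwise on identity arrows, so the value is an idempotent
    of the indecomposable ring [R]. *)
Lemma diagonal_idempotent f x : diagonal f -> convolution f f = f ->
  f (gid x) <> 0 -> f (gid x) = 1.
Proof.
move=> [_ fu] ff; case: (R_indec.2 (f (gid x))) => //.
by rewrite -[in RHS]ff convolution_unitr// gd_id.
Qed.


Lemma convolution_indI V W :
  V `<=` range (@gid X) -> W `<=` range (@gid X) ->
  convolution (ind V 1) (ind W 1) = ind (V `&` W) 1 :> (arr X -> R).
Proof.
move=> Vu Wu; apply/funext => c.
rewrite convolution_unitr; last exact: subset_trans (@supp_ind _ _ _ _) Wu.
have [Vc|nVc] := pselect (V c); last first.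
  by rewrite (ind_notin _ nVc) mul0r ind_notin // => -[].
have -> : gid (gd c) = c by apply/range_gidE/Vu.
rewrite ind_in// mul1r; have [Wc|nWc] := pselect (W c).
  by rewrite !ind_in.
by rewrite (ind_notin _ nWc) ind_notin // => -[].
Qed.

Lemma convolution_ind_source V r : compact_bisection V ->
  convolution (ind V 1) (ind (source V) r) = ind V r :> (arr X -> R).
Proof.
move=> bV; apply/funext => c.
have su : supp (ind (source V) r) `<=` range (@gid X).
  exact: subset_trans (@supp_ind _ _ _ _) (@source_sub _ _ _).
rewrite convolution_unitr//; have [Vc|nVc] := pselect (V c).
  by rewrite !ind_in ?mul1r//; exact: source_id.
by rewrite !(ind_notin _ nVc) mul0r.
Qed.

Lemma convolution_ind_invl V : compact_bisection V ->
  convolution (ind (@ginv X @^-1` V) 1) (ind V 1) =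
    ind (source V) 1 :> (arr X -> R).
Proof.
move=> bV; rewrite convolution_ind// mulr1; congr ind.
apply/seteqP; split=> [_ [a [b [/= Va Vb ab ->]]]|_ [b Vb <-]].
  have <- : ginv a = b by apply: (bisection_gr_inj bV); rewrite // gr_inv.
  by exists (ginv a); rewrite // gcompVr gd_inv.
by exists (ginv b), b; rewrite /= ginvK gd_inv gcompVl.
Qed.

Lemma normalizer_ind V :
  compact_bisection V -> normalizer (ind V 1 : arr X -> R).
Proof.
move=> bV; have bV' := compact_bisection_inv bV.
have V'K : @ginv X @^-1` (@ginv X @^-1` V) = V.
  by apply/seteqP; split=> a; rewrite /= ginvK.
have [_ _ [g Vg]] := bV; exists g => //; split.
  by split; [exact: algebra_ind|apply: subset_trans Vg; exact: supp_ind].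
exists (ind (@ginv X @^-1` V) 1).
have E W : compact_bisection W -> convolution
    (convolution (ind W 1) (ind (@ginv X @^-1` W) 1)) (ind W 1) =
    ind W 1 :> (arr X -> R).
  move=> bW; have bW' := compact_bisection_inv bW.
  have W'K : @ginv X @^-1` (@ginv X @^-1` W) = W.
    by apply/seteqP; split=> a; rewrite /= ginvK.
  rewrite -[X in convolution (convolution (ind X 1) _)]W'K convolution_ind_invl//.
  apply/funext => c; rewrite convolution_unitl; last first.
    exact: subset_trans (@supp_ind _ _ _ _) (@source_sub _ _ _).
  have [Wc|nWc] := pselect (W c); last by rewrite !(ind_notin _ nWc) mulr0.
  rewrite !ind_in ?mulr1// -gd_inv; apply: source_id.
  by rewrite /= ginvK.
have C W f : compact_bisection W -> diagonal f -> diagonal (convolution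
    (convolution (ind W 1) f) (ind (@ginv X @^-1` W) 1)).
  move=> bW [Af fu]; have bW' := compact_bisection_inv bW; split.
    by do 2?apply: algebra_convolution => //; exact: algebra_ind.
  move=> c /convolution_neq0[a [ac + /ind_neq0 /= Wa]].
  rewrite convolution_unitr// => h.
  have /ind_neq0 Wca : ind W 1 (gcomp c (ginv a)) <> 0 :> R.
    by move=> e; apply: h; rewrite e mul0r.
  (* Both arrows lie in [W] and have the same source, so they agree and [c] is an identity arrow. *)
  have : gcomp c (ginv a) = ginv a.
    by apply: (bisection_gd_inj bW) => //; rewrite gd_comp ?gr_inv.
  move=> e; exists (gd a) => //.
  by rewrite -(gcompVK (esym ac)) e gcompVl.
split.
- split; first exact: algebra_ind.
  by move=> a /ind_neq0 /Vg /=; rewrite cocycleV => <-; rewrite invgK.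
- exact: E.
- by have := E _ bV'; rewrite V'K.
- move=> f df; split; first exact: C.
  by have := C _ f bV' df; rewrite V'K.
Qed.

End Diagonal.

(** * Correspondence of objects *)

(** Inclusions replace equalities here, so that a map and its inverse satisfy the same conditions
    and the lemmas apply with the two groupoids exchanged. *)
Record diagonal_graded_hom (R : comPzRingType) (G : groupType)
    (X Y : gradedGroupoid G) (Phi : (arr X -> R) -> arr Y -> R) : Prop := {
  hom_algebra : forall f, groupoid_algebra f -> groupoid_algebra (Phi f);
  homD : forall f g, groupoid_algebra f -> groupoid_algebra g ->
    Phi (f + g) = Phi f + Phi g;
  homM : forall f g, groupoid_algebra f -> groupoid_algebra g ->
    Phi (convolution f g) = convolution (Phi f) (Phi g);
  hom_diagonal : forall f, diagonal f -> diagonal (Phi f);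
  hom_homogeneous : forall g f, homogeneous (X := X) g f ->
    homogeneous (X := Y) g (Phi f)
}.

Lemma hom0 (R : comPzRingType) (G : groupType) (X Y : gradedGroupoid G)
    (Phi : (arr X -> R) -> arr Y -> R) :
  hausdorff_groupoid X -> diagonal_graded_hom Phi -> Phi 0 = 0.
Proof.
move=> hX hPhi; have A0 := @algebra0 R _ X hX.
by apply: (@addrI _ (Phi 0)); rewrite -(homD hPhi)// !addr0.
Qed.

Section Isomorphism.
Variables (R : comPzRingType) (G : groupType) (X Y : gradedGroupoid G).
Hypothesis R_indec : indecomposable R.
Hypotheses (X_ample : ample X) (X_hausdorff : hausdorff_groupoid X).
Hypotheses (Y_ample : ample Y) (Y_hausdorff : hausdorff_groupoid Y).
Variables (Phi : (arr X -> R) -> arr Y -> R) (Psi : (arr Y -> R) -> arr X -> R).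
Hypotheses (Phi_hom : diagonal_graded_hom Phi).
Hypotheses (Psi_hom : diagonal_graded_hom Psi).
Hypothesis PhiK : forall f, groupoid_algebra f -> Psi (Phi f) = f.
Hypothesis PsiK : forall f, groupoid_algebra f -> Phi (Psi f) = f.

(** Vanishing is compared instead of values, since a ring isomorphism may change values, for example
    through an automorphism of [R]. *)
Definition object_rel (y : obj Y) (x : obj X) : Prop :=
  forall f, diagonal f -> f (gid y) = 0 <-> Psi f (gid x) = 0.

Lemma object_rel_ind y x V r : object_rel y x -> compact_bisection V ->
  V `<=` range (@gid Y) -> V (gid y) -> r <> 0 ->
  Psi (ind V r) (gid x) <> 0.
Proof.
move=> yx bV Vu Vy r0 e; apply: r0; rewrite -(ind_in r Vy).
by apply/yx; first exact: diagonal_ind.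
Qed.

Lemma hom_ind_idempotent V x : compact_bisection V -> V `<=` range (@gid Y) ->
  Psi (ind V 1) (gid x) <> 0 -> Psi (ind V 1) (gid x) = 1.
Proof.
move=> bV Vu; apply: diagonal_idempotent => //.
  by apply: (hom_diagonal Psi_hom); exact: diagonal_ind.
have AV := algebra_ind Y_hausdorff (1 : R) bV.
by rewrite -(homM Psi_hom)// convolution_indI// setIid.
Qed.

(** The supports of [Psi (ind V 1)], for compact open sets [V] of identity arrows around [gid y],
    are compact, nonempty because [Psi] is injective, and filtered because products of indicators
    are indicators of intersections. A cluster point of this filter is the identity arrow at [x]. *)
Lemma object_rel_ex y : exists x, object_rel y x.
Proof.
pose D : set (set (arr Y)) :=
  [set V | [/\ compact_bisection V, V `<=` range (@gid Y) & V (gid y)]].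
pose B V := supp (Psi (ind V 1)).
have uy : nbhs (gid y) (range (@gid Y)).
  by apply: open_nbhs_nbhs; split; [exact: open_range_gid Y_ample.1|exists y].
have [V0 [bV0 V0y V0u]] := compact_bisection_basis Y_ample uy.
have DV0 : D V0 by [].
have A V : D V -> groupoid_algebra (Psi (ind V 1)).
  by move=> [bV _ _]; apply: (hom_algebra Psi_hom); exact: algebra_ind.
have dA V : D V -> diagonal (Psi (ind V 1)).
  by move=> [bV Vu _]; apply: (hom_diagonal Psi_hom); exact: diagonal_ind.
pose F := filter_from D B.
have FF : ProperFilter F.
  apply: filter_from_proper; first apply: filter_from_filter.
  - by exists V0.
  - move=> V W DV DW; have [bV Vu Vy] := DV; have [bW Wu Wy] := DW.
    exists (V `&` W).
      split=> //; last by move=> a [/Vu].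
      apply: compact_bisectionI bV; first exact: bisection_open bW.
      exact: compact_closed Y_hausdorff (bisection_compact bW).
    have E : Psi (ind (V `&` W) 1) =
        convolution (Psi (ind V 1)) (Psi (ind W 1)).
      by rewrite -convolution_indI// (homM Psi_hom)//; exact: algebra_ind.
    move=> a; rewrite /B /supp /= E => h; split=> e; apply: h.
      by rewrite convolution_unitr ?e ?mul0r//; case: (dA W DW).
    by rewrite convolution_unitl ?e ?mulr0//; case: (dA V DV).
  - move=> V DV; have [bV Vu Vy] := DV; apply: contrapT => nB.
    have E : Psi (ind V 1) = 0.
      apply/funext => a; apply: contrapT => h; apply: nB; exists a; exact: h.
    have := PsiK (algebra_ind Y_hausdorff (1 : R) bV).
    rewrite E (hom0 X_hausdorff Phi_hom) => /(congr1 (@^~ (gid y))).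
    by rewrite ind_in// => e; apply: (oneN0 R_indec).
have FV0 : F (B V0) by exists V0.
have [t [V0t clt]] := (A V0 DV0).2 F FF FV0.
have [_ /(_ _ V0t) [x _ xt]] := dA V0 DV0.
exists x.
(* The supports are closed, so the cluster point lies in every one of them. *)
have Bx V : D V -> Psi (ind V 1) (gid x) <> 0.
  move=> DV; have cB : closed (B V).
    exact: (locally_constant_closed (P := ~` [set 0]) (A V DV).1).
  suff : B V t by rewrite -xt.
  apply: cB; move: clt; rewrite clusterE; apply.
  by exists V.
(* Choose [V] where [f] vanishes: the product of [ind V 1] and [f] is 0, and [Psi (ind V 1)] equals
   1 at [gid x]. *)
have zero f : diagonal f -> f (gid y) = 0 -> Psi f (gid x) = 0.
  move=> df fy0; have nf : nbhs (gid y) (f @^-1` [set 0]).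
    by apply: open_nbhs_nbhs; split=> //; exact: locally_constant_open df.1.1.
  have [V [bV Vy Vf]] := compact_bisection_basis Y_ample (filterI uy nf).
  have Vu : V `<=` range (@gid Y) by move=> a /Vf[].
  have DV : D V by [].
  have := hom_ind_idempotent bV Vu (Bx _ DV).
  have : convolution (Psi (ind V 1)) (Psi f) = 0.
    rewrite -(homM Psi_hom) ?(hom0 Y_hausdorff Psi_hom)//; last 2 first.
    - exact: algebra_ind.
    - exact: df.1.
    suff -> : convolution (ind V 1) f = 0 by exact: hom0 Psi_hom.
    apply/funext => c; rewrite convolution_unitr; last exact: df.2.
    have [Vc|nVc] := pselect (V c); last by rewrite ind_notin// mul0r.
    have /range_gidE -> := Vu _ Vc.
    by have [_ ->] := Vf _ Vc; rewrite mulr0.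
  move=> /(congr1 (@^~ (gid x))); rewrite convolution_unitr; last first.
    by have [] := hom_diagonal Psi_hom df.
  by rewrite gd_id => + e; rewrite e mul1r.
move=> f df; split; first exact: zero.
(* For the converse, the same argument runs in [X] with a set [E] where [Psi f] vanishes; the
   implication just proved shows that the idempotent [Phi (ind E 1)] is nonzero at [gid y], hence 1
   there. *)
move=> fx0; have dPf := hom_diagonal Psi_hom df.
have nf : nbhs (gid x) (Psi f @^-1` [set 0]).
  by apply: open_nbhs_nbhs; split=> //; exact: locally_constant_open dPf.1.1.
have ux : nbhs (gid x) (range (@gid X)).
  by apply: open_nbhs_nbhs; split; [exact: open_range_gid X_ample.1|exists x].
have [E [bE Ex Ef]] := compact_bisection_basis X_ample (filterI ux nf).
have Eu : E `<=` range (@gid X) by move=> a /Ef[].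
have AE := algebra_ind X_hausdorff (1 : R) bE.
have dE := diagonal_ind X_hausdorff (1 : R) bE Eu.
set e := Phi (ind E 1).
have de : diagonal e by exact: hom_diagonal Phi_hom _ dE.
have ey : e (gid y) = 1.
  apply: diagonal_idempotent => //.
    by rewrite -(homM Phi_hom)// convolution_indI// setIid.
  move=> /(zero _ de); rewrite PhiK// ind_in//.
  exact: oneN0.
have : convolution e f = 0.
  rewrite -(PsiK df.1) -(homM Phi_hom)//; last exact: dPf.1.
  suff -> : convolution (ind E 1) (Psi f) = 0 by exact: hom0 Phi_hom.
  apply/funext => c; rewrite convolution_unitr; last exact: dPf.2.
  have [Ec|nEc] := pselect (E c); last by rewrite ind_notin// mul0r.
  have /range_gidE -> := Eu _ Ec.
  by have [_ ->] := Ef _ Ec; rewrite mulr0.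
move=> /(congr1 (@^~ (gid y))); rewrite convolution_unitr; last exact: df.2.
by rewrite gd_id ey mul1r.
Qed.

End Isomorphism.

(** * Correspondence of arrows *)

Lemma hom_normalizer (R : comPzRingType) (G : groupType) (X Y : gradedGroupoid G)
    (Phi : (arr X -> R) -> arr Y -> R) (Psi : (arr Y -> R) -> arr X -> R) m :
  ample X -> hausdorff_groupoid X ->
  diagonal_graded_hom Phi -> diagonal_graded_hom Psi ->
  (forall f, groupoid_algebra f -> Phi (Psi f) = f) ->
  normalizer m -> normalizer (Phi m).
Proof.
move=> X_ample X_hausdorff hPhi hPsi PsiK [g _ [Hm [m' [Hm' mm'm m'mm' conj]]]].
have Am := Hm.1; have Am' := Hm'.1.
have Ac (f h : arr X -> R) : groupoid_algebra f -> groupoid_algebra h ->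
  groupoid_algebra (convolution f h) by exact: algebra_convolution.
exists g => //; split; first exact: hom_homogeneous hPhi _ _ Hm.
exists (Phi m'); split.
- exact: hom_homogeneous hPhi _ _ Hm'.
- by rewrite -!(homM hPhi) ?mm'm//; exact: Ac.
- by rewrite -!(homM hPhi) ?m'mm'//; exact: Ac.
- move=> f df; have dPf := hom_diagonal hPsi df.
  have [c1 c2] := conj _ dPf; rewrite -(PsiK _ df.1).
  have Af := dPf.1; split; rewrite -!(homM hPhi)//; try exact: Ac.
    exact: hom_diagonal hPhi _ c1.
  exact: hom_diagonal hPhi _ c2.
Qed.

Section Arrows.
Variables (R : comPzRingType) (G : groupType) (X Y : gradedGroupoid G).
Hypothesis R_indec : indecomposable R.
Hypotheses (X_ample : ample X) (X_hausdorff : hausdorff_groupoid X).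
Hypotheses (Y_ample : ample Y) (Y_hausdorff : hausdorff_groupoid Y).
Hypothesis X_bisec : local_bisection_hypothesis R X.
Variables (Phi : (arr X -> R) -> arr Y -> R) (Psi : (arr Y -> R) -> arr X -> R).
Hypotheses (Phi_hom : diagonal_graded_hom Phi).
Hypotheses (Psi_hom : diagonal_graded_hom Psi).
Hypothesis PhiK : forall f, groupoid_algebra f -> Psi (Phi f) = f.
Hypothesis PsiK : forall f, groupoid_algebra f -> Phi (Psi f) = f.

(** All uses of the local bisection hypothesis pass through this lemma. *)
Lemma local_bisection_Psi V : compact_bisection V ->
  local_bisection (supp (Psi (ind V 1))).
Proof.
move=> bV; apply: X_bisec; apply: (hom_normalizer _ _ Psi_hom Phi_hom) => //.
exact: normalizer_ind.
Qed.

Lemma supp_Psi_gd_inj V a b : compact_bisection V ->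
  Psi (ind V 1) a <> 0 -> Psi (ind V 1) b <> 0 -> gd a = gd b -> a = b.
Proof.
by move=> /local_bisection_Psi[_ + _] Va Vb; apply; apply/mem_set.
Qed.

Lemma supp_Psi_gr_inj V a b : compact_bisection V ->
  Psi (ind V 1) a <> 0 -> Psi (ind V 1) b <> 0 -> gr a = gr b -> a = b.
Proof.
by move=> /local_bisection_Psi[_ _ +] Va Vb; apply; apply/mem_set.
Qed.

(** A substitute for linearity over [R]: the scalar is moved into a diagonal factor, on which [Psi]
    is multiplicative. *)
Lemma Psi_ind V r d : compact_bisection V -> Psi (ind V r) d =
  Psi (ind V 1) d * Psi (ind (source V) r) (gid (gd d)).
Proof.
move=> bV; have bs := compact_bisection_source Y_ample bV.
rewrite -convolution_ind_source// (homM Psi_hom); try exact: algebra_ind.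
rewrite convolution_unitr//.
by have [] := hom_diagonal Psi_hom (diagonal_source Y_ample Y_hausdorff r bV).
Qed.

Section Core.
Variables (V : set (arr Y)) (a : arr Y) (d : arr X).
Hypotheses (bV : compact_bisection V) (Va : V a).
Hypotheses (Vd : Psi (ind V 1) d <> 0).
Hypothesis ad : object_rel Psi (gd a) (gd d).

Let m := Psi (ind V 1).
Let m' := Psi (ind (@ginv Y @^-1` V) 1).

(** Both sides are the value of [Psi (ind (source V) 1)] at the source of [d]: it is a nonzero value
    of a diagonal idempotent, hence 1, and as a convolution it has only the term at [d], the support
    of [m] being a bisection. *)
Lemma Psi_inv_mul : m' (ginv d) * m d = 1.
Proof.
have bs := compact_bisection_source Y_ample bV.
have bV' := compact_bisection_inv bV.
have : Psi (ind (source V) 1) (gid (gd d)) = 1.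
  apply: (hom_ind_idempotent R_indec Y_hausdorff Psi_hom bs (@source_sub _ _ _)).
  apply: (object_rel_ind Y_hausdorff ad bs (@source_sub _ _ _)).
    exact: source_id.
  exact: oneN0.
rewrite -convolution_ind_invl// (homM Psi_hom); try exact: algebra_ind.
rewrite (@convolution_single _ _ _ _ _ d) ?gd_id//.
  by rewrite -[X in gid X]gr_inv gcomp1l.
by move=> b bd _ mb; apply: (supp_Psi_gd_inj bV).
Qed.

Lemma Psi_local W : compact_bisection W -> Psi (ind W 1) d <> 0 -> W a.
Proof.
move=> bW Wd; set mW := Psi (ind W 1) in Wd *.
have bV' := compact_bisection_inv bV.
have Am' : groupoid_algebra m'.
  by apply: (hom_algebra Psi_hom); exact: algebra_ind.
have AmW : groupoid_algebra mW.
  by apply: (hom_algebra Psi_hom); exact: algebra_ind.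
have n1 : nbhs d (mW @^-1` [set mW d]).
  by apply: open_nbhs_nbhs; split=> //; exact: locally_constant_open AmW.1.
have n2 : nbhs d (@ginv X @^-1` (m' @^-1` [set m' (ginv d)])).
  apply: continuous_ginv; apply: open_nbhs_nbhs; split=> //.
  exact: locally_constant_open Am'.1.
(* On [B] the factors [mW] and, after inversion, [m'] are constant, so the product cut down to the
   source of [B] becomes a constant multiple of an indicator. *)
have [B [bB Bd BP]] := compact_bisection_basis X_ample (filterI n1 n2).
have BW b : B b -> mW b = mW d by move=> /BP[].
have BV b : B b -> m' (ginv b) = m' (ginv d) by move=> /BP[].
have m'd : m' (ginv d) <> 0.
  by move=> e; have := Psi_inv_mul; rewrite e mul0r => /esym; exact: oneN0.
pose E := source B; pose k := m' (ginv d) * mW d.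
have bE : compact_bisection E by exact: compact_bisection_source.
have Eu : E `<=` range (@gid X) by exact: source_sub.
have iEu r : supp (ind E r : _ -> R) `<=` range (@gid X).
  exact: subset_trans (@supp_ind _ _ _ _) Eu.
have kE : convolution m' (convolution mW (ind E 1)) = ind E k.
  apply/funext => c; have [Ec|nEc] := pselect (E c).
    have [b Bb bc] := Ec; rewrite ind_in//.
    rewrite (@convolution_single _ _ _ _ _ b) -?bc ?gd_id//.
      rewrite -[X in gid X]gr_inv gcomp1l convolution_unitr// BV// BW//.
      by rewrite ind_in ?mulr1//; exact: source_id.
    move=> e eb _; rewrite convolution_unitr// => h.
    apply: (supp_Psi_gd_inj bW) => //; last by rewrite -/mW BW.
    by move=> e0; apply: h; rewrite /mW e0 mul0r.
  (* Off [E] a nonzero term would have its right factor [b] in [B]; then [gcomp c (ginv b)] and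
     [ginv b] lie in the bisection supporting [m'] with the same source, which puts [c] in [E]. *)
  rewrite [RHS]ind_notin//; apply: contrapT => /convolution_neq0.
  move=> [b [bc h]]; rewrite convolution_unitr// => h'; apply: nEc.
  have Wb : mW b <> 0 by move=> e; apply: h'; rewrite e mul0r.
  have /ind_neq0 [b' Bb' /(congr1 (@gd X))] : ind E 1 (gid (gd b)) <> 0 :> R.
    by move=> e; apply: h'; rewrite e mulr0.
  rewrite !gd_id => b'b.
  have b'E : b' = b by apply: (supp_Psi_gd_inj bW) => //; rewrite -/mW BW.
  move: b'b => _; subst b'.
  have cb : gcomp c (ginv b) = ginv b.
    apply: (supp_Psi_gd_inj bV') => //; first by rewrite -/m' BV.
    by rewrite gd_comp// gr_inv.
  have -> : c = gid (gd b) by rewrite -(gcompVK (esym bc)) cb gcompVl.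
  exact: source_id.
have AE := algebra_ind X_hausdorff (1 : R) bE.
have dk := diagonal_ind X_hausdorff k bE Eu.
have PE : Phi (ind E k) = convolution (ind (@ginv Y @^-1` V) 1)
    (convolution (ind W 1) (Phi (ind E 1))).
  rewrite -kE !(homM Phi_hom)//; last exact: algebra_convolution.
  by rewrite !PsiK//; exact: algebra_ind.
(* The scalar [k] is nonzero because [m d * k = mW d] by [Psi_inv_mul]. *)
have : Phi (ind E k) (gid (gd a)) <> 0.
  move=> /(ad (hom_diagonal Phi_hom dk)); rewrite PhiK; last exact: dk.1.
  rewrite ind_in; last exact: source_id.
  move=> k0; apply: Wd; rewrite -[RHS](mulr0 (m d)) -k0 /k mulrA.
  by rewrite [m d * _]mulrC Psi_inv_mul mul1r.
rewrite PE => /convolution_neq0[b []]; rewrite gd_id => ba.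
move=> /ind_neq0 /=; rewrite -ba -[X in gid X]gr_inv gcomp1l ginvK => Vb.
(* The factor [b] lies in [V] over the source of [a], so it is [a] itself, and [ind W 1] is nonzero
   there. *)
have -> : b = a by exact: (bisection_gd_inj bV).
rewrite convolution_unitr; last first.
  by have [] := hom_diagonal Phi_hom (diagonal_ind X_hausdorff 1 bE Eu).
by move=> h; apply: (@ind_neq0 R _ W 1) => e; apply: h; rewrite e mul0r.
Qed.

(** In a decomposition of [f] over bisections inside its support, none contains [a]; by [Psi_local]
    each [Psi (ind W 1)] vanishes at [d]. *)
Lemma Psi_zero f : groupoid_algebra f -> f a = 0 -> Psi f d = 0.
Proof.
move=> Af fa.
suff [] : groupoid_algebra f /\ Psi f d = 0 by [].
apply: (algebra_span Y_ample Y_hausdorff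
    (Z := fun f => groupoid_algebra f /\ Psi f d = 0) Af).
- by split; [exact: algebra0|rewrite (hom0 Y_hausdorff Psi_hom)].
- move=> f1 f2 [A1 f1d] [A2 f2d]; split; first exact: algebraD.
  by rewrite (homD Psi_hom)// fctE f1d f2d addr0.
- move=> W r bW Wf; split; first exact: algebra_ind.
  rewrite Psi_ind//; have [->|] := pselect (Psi (ind W 1) d = 0).
    by rewrite mul0r.
  by move=> /(Psi_local bW) /Wf; rewrite /supp /= fa.
Qed.

Lemma Psi_value f : groupoid_algebra f -> f a = 0 <-> Psi f d = 0.
Proof.
move=> Af; split; first exact: Psi_zero.
have bs := compact_bisection_source Y_ample bV.
have AV r := algebra_ind Y_hausdorff (r : R) bV.
(* Subtracting the value at [a] along [V] leaves a function covered by [Psi_zero]. What remains is a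
   multiple of an indicator, whose image at [d] has the invertible factor [m d]. *)
pose h := f + ind V (- f a).
have Ah : groupoid_algebra h by exact: algebraD.
have ha : h a = 0 by rewrite /h fctE ind_in// addrN.
have hd : Psi h d = 0 by exact: Psi_zero.
have -> : f = h + ind V (f a).
  apply/funext => c; rewrite /h !fctE; have [Vc|nVc] := pselect (V c).
    by rewrite !ind_in// subrK.
  by rewrite !(ind_notin _ nVc) !addr0.
rewrite (homD Psi_hom)// !fctE hd ha !add0r Psi_ind// (ind_in _ Va).
move=> e; apply: contrapT => fa0.
apply: (object_rel_ind Y_hausdorff ad bs (@source_sub _ _ _) _ fa0).
  exact: source_id.
by rewrite -[LHS]mul1r -Psi_inv_mul -mulrA e mulr0.
Qed.

End Core.

Definition arrow_rel (a : arr Y) (d : arr X) : Prop :=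
  forall f, groupoid_algebra f -> f a = 0 <-> Psi f d = 0.

(** The product of the images of the indicators of the inverse of [V] and of [V] is nonzero at the
    object matching the source of [a]; a nonzero term of it supplies [d]. *)
Lemma arrow_rel_exr a : exists d, arrow_rel a d.
Proof.
have [x ax] := object_rel_ex R_indec X_ample X_hausdorff Y_ample Y_hausdorff
  Phi_hom Psi_hom PhiK PsiK (gd a).
have [V [bV Va _]] := compact_bisection_basis Y_ample (filterT : nbhs a setT).
have bs := compact_bisection_source Y_ample bV.
have bV' := compact_bisection_inv bV.
have := object_rel_ind Y_hausdorff ax bs (@source_sub _ _ _) (source_id Va)
  (oneN0 R_indec).
rewrite -convolution_ind_invl// (homM Psi_hom); try exact: algebra_ind.
move=> /convolution_neq0[d []]; rewrite gd_id => dx _ Vd.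
by exists d => f; apply: (Psi_value bV) => //; rewrite dx.
Qed.

Lemma arrow_rel_exl d : exists a, arrow_rel a d.
Proof.
have [y] := object_rel_ex R_indec Y_ample Y_hausdorff X_ample X_hausdorff
  Psi_hom Phi_hom PsiK PhiK (gd d).
move=> dy; have yd : object_rel Psi y (gd d).
  move=> f df; rewrite -{1}(PsiK df.1); apply: iff_sym; apply: dy.
  exact: hom_diagonal Psi_hom _ df.
have [U [bU Ud _]] := compact_bisection_basis X_ample (filterT : nbhs d setT).
have AU := algebra_ind X_hausdorff (1 : R) bU.
(* If every [Psi (ind V 1)] vanished at [d], then by additive induction so would
   [Psi (Phi (ind U 1))], whose value there is 1. *)
have [V bV Vd] : exists2 V, compact_bisection V & Psi (ind V 1) d <> 0.
  apply: contrapT => nV; apply: (oneN0 R_indec).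
  rewrite -(ind_in (1 : R) Ud) -(PhiK AU).
  suff [] : groupoid_algebra (Phi (ind U 1)) /\ Psi (Phi (ind U 1)) d = 0 by [].
  apply: (algebra_span Y_ample Y_hausdorff
    (Z := fun f => groupoid_algebra f /\ Psi f d = 0)).
  - exact: (hom_algebra Phi_hom).
  - by split; [exact: algebra0|rewrite (hom0 Y_hausdorff Psi_hom)].
  - move=> f1 f2 [A1 f1d] [A2 f2d]; split; first exact: algebraD.
    by rewrite (homD Psi_hom)// fctE f1d f2d addr0.
  - move=> W r bW _; split; first exact: algebra_ind.
    rewrite Psi_ind//; have [->|] := pselect (Psi (ind W 1) d = 0).
      by rewrite mul0r.
    by move=> h; exfalso; apply: nV; exists W.
have Vs : Psi (ind (source V) 1) (gid (gd d)) <> 0.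
  by move=> e; apply: Vd; rewrite Psi_ind// e mulr0.
(* Since [Psi (ind (source V) 1)] is nonzero at the source of [d], the matching object [y] is the
   source of an arrow of [V], which is the desired [a]. *)
have : source V (gid y).
  apply: contrapT => nVy; apply: Vs; apply/yd; first exact: diagonal_source.
  by rewrite ind_notin.
move=> [a Va /(congr1 (@gd Y))]; rewrite !gd_id => ay.
by exists a => f; apply: (Psi_value bV) => //; rewrite ay.
Qed.

End Arrows.

(** * Reconstruction of the groupoid *)

Lemma hausdorff_neq_nbhs (T : topologicalType) (s t : T) :
  hausdorff_space T -> s <> t -> nbhs s (~` [set t]).
Proof.
move=> hT st; apply: open_nbhs_nbhs; split=> //; apply: closed_openC.
by apply: compact_closed => //; exact: compact_set1.
Qed.

Lemma algebra_separates (R : comPzRingType) (G : groupType) (X : gradedGroupoid G)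
    (a a' : arr X) :
  indecomposable R -> ample X -> hausdorff_groupoid X ->
  (forall f : arr X -> R, groupoid_algebra f -> f a = 0 <-> f a' = 0) -> a = a'.
Proof.
move=> R_indec X_ample X_hausdorff aa'; apply: contrapT => ne.
have [V [bV Va Va']] :=
  compact_bisection_basis X_ample (hausdorff_neq_nbhs X_hausdorff ne).
apply: (oneN0 R_indec); rewrite -(ind_in (1 : R) Va).
apply/(aa' _ (algebra_ind X_hausdorff (1 : R) bV)).
by apply: ind_notin => /Va'; exact.
Qed.

Section Transport.
Variables (R : comPzRingType) (G : groupType) (X Y : gradedGroupoid G).
Hypothesis R_indec : indecomposable R.
Hypotheses (X_ample : ample X) (X_hausdorff : hausdorff_groupoid X).
Variables (Phi : (arr X -> R) -> arr Y -> R) (phi : arr X -> arr Y).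
Hypothesis Phi_hom : diagonal_graded_hom Phi.
Hypothesis Phi_phi : forall f a, groupoid_algebra f ->
  f a = 0 <-> Phi f (phi a) = 0.

Lemma transport_ind V a : compact_bisection V ->
  V a <-> Phi (ind V 1) (phi a) <> 0.
Proof.
move=> bV; have h := Phi_phi a (algebra_ind X_hausdorff (1 : R) bV).
split=> [Va /h|nV]; first by rewrite ind_in//; exact: oneN0.
by apply: contrapT => Va; apply: nV; apply/h; rewrite ind_notin.
Qed.

Lemma transport_unit x : range (@gid Y) (phi (gid x)).
Proof.
have ux : nbhs (gid x) (range (@gid X)).
  by apply: open_nbhs_nbhs; split; [exact: open_range_gid X_ample.1|exists x].
have [V [bV Vx Vu]] := compact_bisection_basis X_ample ux.
have [_] := hom_diagonal Phi_hom (diagonal_ind X_hausdorff (1 : R) bV Vu).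
by apply; apply/transport_ind.
Qed.

Lemma transport_cocycle a : cocycle (phi a) = cocycle a.
Proof.
have [V [bV Va _]] := compact_bisection_basis X_ample (filterT : nbhs a setT).
have [_ _ [g Vg]] := bV; rewrite (Vg _ Va).
have hV : homogeneous g (ind V 1 : arr X -> R).
  split; first exact: algebra_ind.
  by apply: subset_trans Vg; exact: supp_ind.
have [_] := hom_homogeneous Phi_hom hV; apply.
exact/transport_ind.
Qed.

(** The preimage of [V] under [psi] is the support of [Phi (ind V 1)], which is open. *)
Lemma transport_continuous (psi : arr Y -> arr X) :
  cancel psi phi -> continuous psi.
Proof.
move=> psiK b O; rewrite nbhs_simpl /= => nO.
have [V [bV Vb VO]] := compact_bisection_basis X_ample nO.
have AV := hom_algebra Phi_hom (algebra_ind X_hausdorff (1 : R) bV).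
have : nbhs b (Phi (ind V 1) @^-1` (~` [set 0])).
  apply: open_nbhs_nbhs; split; first exact: locally_constant_open AV.1.
  by rewrite /= -[b]psiK; apply/transport_ind.
apply: filterS => c /= Vc; apply: VO; apply/transport_ind => //.
by rewrite psiK.
Qed.

End Transport.

Section Reconstruction.
Variables (R : comPzRingType) (G : groupType) (X Y : gradedGroupoid G).
Hypothesis R_indec : indecomposable R.
Hypotheses (X_ample : ample X) (X_hausdorff : hausdorff_groupoid X).
Hypotheses (Y_ample : ample Y) (Y_hausdorff : hausdorff_groupoid Y).
Hypothesis X_bisec : local_bisection_hypothesis R X.
Variables (Phi : (arr X -> R) -> arr Y -> R) (Psi : (arr Y -> R) -> arr X -> R).
Hypotheses (Phi_hom : diagonal_graded_hom Phi).
Hypotheses (Psi_hom : diagonal_graded_hom Psi).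
Hypothesis PhiK : forall f, groupoid_algebra f -> Psi (Phi f) = f.
Hypothesis PsiK : forall f, groupoid_algebra f -> Phi (Psi f) = f.

Section ArrowBijection.
Variables (psi : arr Y -> arr X) (phi : arr X -> arr Y).
Hypothesis Psi_psi : forall f b, groupoid_algebra f ->
  f b = 0 <-> Psi f (psi b) = 0.
Hypotheses (phiK : cancel phi psi) (psiK : cancel psi phi).

Lemma psi_comp a b : gd a = gr b ->
  gd (psi a) = gr (psi b) /\ psi (gcomp a b) = gcomp (psi a) (psi b).
Proof.
move=> ab; set c := psi (gcomp a b).
have psiP W b' : compact_bisection W -> Psi (ind W 1) b' <> 0 <-> W (phi b').
  move=> bW; rewrite -{1}[b']phiK; apply: iff_sym.
  exact: (transport_ind R_indec Y_hausdorff Psi_psi).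
(* The product of the images of two indicators is nonzero at [c], so [c] factors through arrows
   matching [V] and [W], however small these are. *)
have factor V W : compact_bisection V -> compact_bisection W -> V a -> W b ->
    exists b', [/\ gd b' = gd c, V (phi (gcomp c (ginv b'))) & W (phi b')].
  move=> bV bW Va Wb.
  have AV := algebra_ind Y_hausdorff (1 : R) bV.
  have AW := algebra_ind Y_hausdorff (1 : R) bW.
  have : Psi (convolution (ind V 1) (ind W 1)) c <> 0.
    move=> /(Psi_psi _ (algebra_convolution Y_ample Y_hausdorff AV AW)).
    rewrite convolution_ind// ind_in; last by exists a, b.
    by rewrite mulr1; exact: oneN0.
  rewrite (homM Psi_hom)// => /convolution_neq0[b' [b'c h1 h2]].
  by exists b'; split=> //; apply/psiP.
have [V [bV Va _]] := compact_bisection_basis Y_ample (filterT : nbhs a setT).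
have [W [bW Wb _]] := compact_bisection_basis Y_ample (filterT : nbhs b setT).
have [b0 [b0c Va0 Wb0]] := factor V W bV bW Va Wb.
set a0 := gcomp c (ginv b0) in Va0.
have cV b1 : gd b1 = gd c -> gd c = gr (ginv b1) by rewrite gr_inv.
have gra0 : gr a0 = gr c by rewrite gr_comp// (cV _ b0c).
(* Otherwise shrink [W] to avoid [phi b0]. The new right factor of [c] has the source of [b0] and
   lies in the same bisection, so it equals [b0], a contradiction. The left factor is treated alike,
   with ranges. *)
have b0E : b0 = psi b.
  apply: (can_inj phiK); rewrite psiK; apply: contrapT => bb0.
  have [W1 [bW1 W1b W1b0]] := compact_bisection_basis Y_ample
    (filterI (hausdorff_neq_nbhs Y_hausdorff (fun e => bb0 (esym e)))
      (open_nbhs_nbhs (conj (bisection_open bW) Wb))).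
  have [b1 [b1c _ Wb1]] := factor V W1 bV bW1 Va W1b.
  have [/= nb1 WWb1] := W1b0 _ Wb1; apply: nb1; congr phi.
  have inj := supp_Psi_gd_inj Y_ample Y_hausdorff
    X_bisec Phi_hom Psi_hom PhiK bW.
  by apply: inj; [exact/psiP|exact/psiP|rewrite b1c].
have a0E : a0 = psi a.
  apply: (can_inj phiK); rewrite psiK; apply: contrapT => aa0.
  have [V1 [bV1 V1a V1a0]] := compact_bisection_basis Y_ample
    (filterI (hausdorff_neq_nbhs Y_hausdorff (fun e => aa0 (esym e)))
      (open_nbhs_nbhs (conj (bisection_open bV) Va))).
  have [b1 [b1c Va1 _]] := factor V1 W bV1 bW V1a Wb.
  have [/= na1 VVa1] := V1a0 _ Va1; apply: na1; congr phi.
  have inj := supp_Psi_gr_inj Y_ample Y_hausdorff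
    X_bisec Phi_hom Psi_hom PhiK bV.
  by apply: inj; [exact/psiP|exact/psiP|rewrite gra0 gr_comp// (cV _ b1c)].
split; first by rewrite -a0E -b0E gd_comp ?gd_inv// (cV _ b0c).
by rewrite -a0E -b0E gcompVK.
Qed.

End ArrowBijection.

Lemma reconstruction : exists phi : continuousFunctor X Y, graded_isomorphism phi.
Proof.
have [psi psiP] := choice (arrow_rel_exr R_indec X_ample X_hausdorff Y_ample
  Y_hausdorff X_bisec Phi_hom Psi_hom PhiK PsiK).
have [phi phiP] := choice (arrow_rel_exl R_indec X_ample X_hausdorff Y_ample
  Y_hausdorff X_bisec Phi_hom Psi_hom PhiK PsiK).
have Psi_psi f b : groupoid_algebra f -> f b = 0 <-> Psi f (psi b) = 0.
  exact: psiP.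
have Phi_phi f a : groupoid_algebra f -> f a = 0 <-> Phi f (phi a) = 0.
  move=> Af; rewrite -{1}(PhiK Af); apply: iff_sym; apply: phiP.
  exact: hom_algebra Phi_hom _ Af.
have phiK : cancel phi psi.
  move=> a; apply: (algebra_separates R_indec X_ample X_hausdorff) => f Af.
  apply: iff_trans (iff_sym (Phi_phi f a Af)).
  rewrite -{1}(PhiK Af); apply: iff_sym; apply: psiP.
  exact: hom_algebra Phi_hom _ Af.
have psiK : cancel psi phi.
  move=> b; apply: (algebra_separates R_indec Y_ample Y_hausdorff) => f Af.
  exact: iff_trans (phiP _ _ Af) (iff_sym (psiP _ _ Af)).
have psiM a b : gd a = gr b ->
    gd (psi a) = gr (psi b) /\ psi (gcomp a b) = gcomp (psi a) (psi b).
  exact: psi_comp.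
pose psi0 (y : obj Y) := gd (psi (gid y)).
pose phi0 (x : obj X) := gd (phi (gid x)).
have psi_id y : psi (gid y) = gid (psi0 y).
  by apply/esym/range_gidE; apply: (transport_unit R_indec Y_ample Y_hausdorff
    Psi_hom Psi_psi).
have phi_id x : phi (gid x) = gid (phi0 x).
  by apply/esym/range_gidE; apply: (transport_unit R_indec X_ample X_hausdorff
    Phi_hom Phi_phi).
(* Sources are read off from composability: [b] composes with the identity at its source, so their
   images compose too. *)
have psi_d b : gd (psi b) = psi0 (gd b).
  have [|-> _] := psiM b (gid (gd b)); first by rewrite gr_id.
  by rewrite psi_id gr_id.
have psi_r b : gr (psi b) = psi0 (gr b).
  have [|<- _] := psiM (gid (gr b)) b; first by rewrite gd_id.
  by rewrite psi_id gd_id.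
have phi0K : cancel phi0 psi0.
  by move=> x; rewrite /psi0 -phi_id phiK gd_id.
have psi0K : cancel psi0 phi0.
  by move=> y; rewrite /phi0 -psi_id psiK gd_id.
have phi_d a : gd (phi a) = phi0 (gd a).
  by apply: (can_inj psi0K); rewrite -psi_d phiK phi0K.
have phi_r a : gr (phi a) = phi0 (gr a).
  by apply: (can_inj psi0K); rewrite -psi_r phiK phi0K.
have phiM a b : gd a = gr b -> phi (gcomp a b) = gcomp (phi a) (phi b).
  move=> ab; apply: (can_inj psiK).
  have [|_ ->] := psiM (phi a) (phi b); first by rewrite phi_d phi_r ab.
  by rewrite !phiK.
have cpsi : continuous psi.
  exact: (transport_continuous R_indec X_ample X_hausdorff Phi_hom Phi_phi).
have cphi : continuous phi.
  exact: (transport_continuous R_indec Y_ample Y_hausdorff Psi_hom Psi_psi).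
have cpsi0 : continuous psi0.
  move=> y; apply: (@continuous_comp _ _ _ (psi \o @gid Y));
    last exact: continuous_gd.
  by apply: continuous_comp; [exact: continuous_gid|exact: cpsi].
have cphi0 : continuous phi0.
  move=> x; apply: (@continuous_comp _ _ _ (phi \o @gid X));
    last exact: continuous_gd.
  by apply: continuous_comp; [exact: continuous_gid|exact: cphi].
exists (@ContinuousFunctor X Y phi0 phi phi_d phi_r phi_id phiM cphi0 cphi).
split.
  exists (@ContinuousFunctor Y X psi0 psi psi_d psi_r psi_id
    (fun a b ab => (psiM a b ab).2) cpsi0 cpsi).
  by split.
move=> a; exact: (transport_cocycle R_indec X_ample X_hausdorff Phi_hom Phi_phi).
Qed.

End Reconstruction.

(** * From groupoid isomorphisms to algebra isomorphisms *)

Section Pullback.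
Variables (R : comPzRingType) (X Y : topGroupoid).
Variables (phi : continuousFunctor X Y) (psi : continuousFunctor Y X).
Hypotheses (psi0K : cancel (fobj psi) (fobj phi)).
Hypotheses (phiK : cancel phi psi) (psiK : cancel psi phi).
Implicit Types f g : arr X -> R.

Lemma functor_inv a : psi (ginv a) = ginv (psi a).
Proof.
apply: ginv_unique; first by rewrite functor_d functor_r gr_inv.
by rewrite -functor_comp ?gr_inv// gcompVr functor_id functor_r.
Qed.

Lemma supp_pullback f : supp (f \o psi) = phi @` supp f.
Proof.
apply/seteqP; split=> [b fb|_ [a fa <-]]; last by rewrite /supp /= phiK.
by exists (psi b).
Qed.

Lemma pullback_algebra f : groupoid_algebra f -> groupoid_algebra (f \o psi).
Proof.
move=> [lf cf]; split.
  by move=> b; exact: (@continuous_farr _ _ psi b _ (lf (psi b))).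
rewrite supp_pullback; apply: (continuous_image_compact _ cf).
exact: continuous_farr.
Qed.

(** The inverse functor maps each fibre of [gd] bijectively onto a fibre, and the sum is reindexed
    along it. *)
Lemma pullback_convolution f g :
  convolution f g \o psi = convolution (f \o psi) (g \o psi).
Proof.
apply/funext => c; rewrite /convolution /=.
rewrite (@reindex_fsbig _ _ _ _ _ psi [set b | gd b = gd c]).
  apply: eq_fsbigr => b; rewrite inE /= => bc.
  by rewrite functor_comp ?gr_inv// functor_inv.
split.
- by move=> b /= bc; rewrite !functor_d bc.
- by move=> b b' _ _; exact: (can_inj psiK).
- move=> a /= ac; exists (phi a); last by rewrite phiK.
  by rewrite /= functor_d ac functor_d psi0K.
Qed.

Lemma pullback_diagonal f : diagonal f -> diagonal (f \o psi).
Proof.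
move=> [Af fu]; split; first exact: pullback_algebra.
rewrite supp_pullback => _ [a /fu[x _ <-] <-].
by exists (fobj phi x); rewrite // functor_id.
Qed.

End Pullback.

Lemma graded_isomorphism_algebra (G : groupType) (R : comPzRingType)
    (X Y : gradedGroupoid G) (phi : continuousFunctor X Y) :
  graded_isomorphism phi ->
  exists Phi : (arr X -> R) -> (arr Y -> R),
    [/\ algebra_isomorphism Phi, diagonal_preserving Phi & graded_map Phi].
Proof.
move=> [[psi [phi0K psi0K phiK psiK]] cphi].
have phiKf (f : arr X -> R) : (f \o psi) \o phi = f.
  by apply/funext => a /=; rewrite phiK.
have psiKf (f : arr Y -> R) : (f \o phi) \o psi = f.
  by apply/funext => a /=; rewrite psiK.
have Apsi := @pullback_algebra R X Y phi psi phiK psiK.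
have Aphi := @pullback_algebra R Y X psi phi psiK phiK.
have dpsi := @pullback_diagonal R X Y phi psi phiK psiK.
have dphi := @pullback_diagonal R Y X psi phi psiK phiK.
exists (fun f => f \o psi); split.
- split; last by [].
  split=> [|//|f g _ _]; last exact: pullback_convolution psi0K phiK psiK _ _.
  split=> [|f g _ _ fg|f Af]; first exact: Apsi.
    by rewrite -(phiKf f) -(phiKf g) fg.
  by exists (f \o phi); [exact: Aphi|exact: psiKf].
- apply/seteqP; split=> [_ [f df <-]|f df]; first exact: dpsi.
  by exists (f \o phi); [exact: dphi|exact: psiKf].
- move=> g; apply/seteqP; split=> [_ [f [Af fg] <-]|f [Af fg]].
    split; first exact: Apsi.
    by move=> b /fg /= <-; rewrite -cphi psiK.
  exists (f \o phi); last exact: psiKf.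
  split; first exact: Aphi.
  by move=> a /fg /= <-; rewrite cphi.
Qed.

(** * Inverse of a ring isomorphism and the equivalences *)

Lemma ring_isomorphism_hom_inverse (G : groupType) (R : comPzRingType)
    (X Y : gradedGroupoid G) (Phi : (arr X -> R) -> (arr Y -> R)) :
  ample X -> hausdorff_groupoid X -> ample Y -> hausdorff_groupoid Y ->
  ring_isomorphism Phi -> diagonal_preserving Phi -> graded_map Phi ->
  exists Psi : (arr Y -> R) -> (arr X -> R),
    [/\ diagonal_graded_hom Phi, diagonal_graded_hom Psi,
        forall f, groupoid_algebra f -> Psi (Phi f) = f &
        forall f, groupoid_algebra f -> Phi (Psi f) = f].
Proof.
move=> X_ample X_hausdorff Y_ample Y_hausdorff.
move=> [[Phi_fun Phi_inj Phi_surj] PhiD PhiM] Phi_diag Phi_gr.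
(* [Phi] is bijective only between the algebras; elsewhere the chosen preimage is unconstrained, and
   0 serves as witness. *)
have ex_inv (g : arr Y -> R) : exists f : arr X -> R,
    groupoid_algebra g -> groupoid_algebra f /\ Phi f = g.
  have [/Phi_surj[f Af fg]|ng] := pselect (groupoid_algebra g); last by exists 0.
  by exists f.
have [Psi PsiP] := choice ex_inv.
have PsiK g Ag := (PsiP g Ag).2; have APsi g Ag := (PsiP g Ag).1.
have inj f g : groupoid_algebra f -> groupoid_algebra g -> Phi f = Phi g -> f = g.
  by move=> Af Ag; apply: Phi_inj; exact/mem_set.
have PhiK f : groupoid_algebra f -> Psi (Phi f) = f.
  move=> Af; apply: inj => //; first by apply/APsi/Phi_fun.
  by rewrite PsiK//; exact: Phi_fun.
have Ac := algebra_convolution X_ample X_hausdorff.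
have Ac' := algebra_convolution Y_ample Y_hausdorff.
exists Psi; split=> //; split=> //.
- by move=> f df; have : (Phi @` @diagonal R X) (Phi f) by [exists f];
    rewrite Phi_diag.
- by move=> g f hf; have : (Phi @` homogeneous (X := X) g) (Phi f) by [exists f];
    rewrite Phi_gr.
- move=> f g Af Ag; have APf := APsi f Af; have APg := APsi g Ag.
  apply: inj; [by apply: APsi; exact: algebraD|exact: algebraD|].
  by rewrite PhiD// !PsiK//; exact: algebraD.
- move=> f g Af Ag; have APf := APsi f Af; have APg := APsi g Ag.
  apply: inj; [by apply: APsi; exact: Ac'|exact: Ac|].
  by rewrite PhiM// !PsiK//; exact: Ac'.
- move=> f; rewrite -[X in X f]Phi_diag => -[h dh <-].
  by rewrite PhiK//; exact: dh.1.
- move=> g f; rewrite -[X in X f]Phi_gr => -[h hh <-].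
  by rewrite PhiK//; exact: hh.1.
Qed.

Theorem theorem5p6 (G : groupType) (R : comPzRingType)
    (X Y : gradedGroupoid G)
    (R_indec : indecomposable R)
    (X_ample : ample X) (X_hausdorff : hausdorff_groupoid X)
    (Y_ample : ample Y) (Y_hausdorff : hausdorff_groupoid Y)
    (X_bisec : local_bisection_hypothesis R X) :
  [<-> exists phi : continuousFunctor X Y, graded_isomorphism phi;
       exists Phi : (arr X -> R) -> (arr Y -> R),
         [/\ algebra_isomorphism Phi, diagonal_preserving Phi & graded_map Phi];
       exists Phi : (arr X -> R) -> (arr Y -> R),
         [/\ ring_isomorphism Phi, diagonal_preserving Phi & graded_map Phi]].
Proof.
tfae.
- by move=> [phi]; exact: graded_isomorphism_algebra.
- by move=> [Phi [[Phi_iso _] Phi_diag Phi_gr]]; exists Phi.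
- move=> [Phi [Phi_iso Phi_diag Phi_gr]].
  have [Psi [Phi_hom Psi_hom PhiK PsiK]] := ring_isomorphism_hom_inverse
    X_ample X_hausdorff Y_ample Y_hausdorff Phi_iso Phi_diag Phi_gr.
  exact: (reconstruction R_indec X_ample X_hausdorff Y_ample Y_hausdorff X_bisec
    Phi_hom Psi_hom PhiK PsiK).
Qed.
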